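(* The class $\mathcal{M}$ is closed under multiplication: if $m_1, m_2\in\mathcal{M}$, then the pointwise product $m_1m_2$ belongs to $\mathcal{M}$.
   Context: $\mathcal{M}$ denotes the set of functions $m\in C^2[0,1]$ such that: (C1) $m(s)>0$ for $s>0$ and $m(0)=0$; (C2) $m'(s)>0$ for $s>0$ and $m'(0)=0$; (C3) $m''(s)>0$ for $s>0$; (C4) the function $\frac{m''}{m'}$ is decreasing on $(0,1)$. ''Decreasing'' means strictly decreasing. *)

(* Defs.v *)
From Stdlib Require Export Reals.
Open Scope R_scope.

Definition unit_interval (s : R) : Prop := 0 <= s <= 1.

(* [d] is the derivative on [D] of [f], all difference quotients being taken
   inside [D]: at the end points of an interval it is the one-sided one. *)
Definition derivative_on (D : R -> Prop) (f d : R -> R) : Prop :=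
  forall s, D s -> D_in f d D s.

Definition continuous_on (D : R -> Prop) (f : R -> R) : Prop :=
  forall s, D s -> continue_in f D s.

Definition strictly_decreasing_on (D : R -> Prop) (f : R -> R) : Prop :=
  forall s t, D s -> D t -> s < t -> f t < f s.

(* [m] is in C^2[0,1], with first and second derivatives [m'] and [m''] there.
   Only the values on [0,1] matter; they determine [m'] and [m''] on [0,1].
   Continuity of [m] and [m'] follows from differentiability. *)
Definition C2_01 (m m' m'' : R -> R) : Prop :=
  derivative_on unit_interval m m' /\
  derivative_on unit_interval m' m'' /\
  continuous_on unit_interval m''.

Definition class_M (m : R -> R) : Prop :=
  exists m' m'' : R -> R,
    C2_01 m m' m'' /\
    ((forall s, 0 < s <= 1 -> 0 < m s) /\ m 0 = 0) /\
    ((forall s, 0 < s <= 1 -> 0 < m' s) /\ m' 0 = 0) /\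
    (forall s, 0 < s <= 1 -> 0 < m'' s) /\
    strictly_decreasing_on (fun s => 0 < s < 1) (fun s => m'' s / m' s).

(* Main.v *)
Require Import Defs.
From Stdlib Require Import Reals Lra.
From Coquelicot Require Import Rcomplements.
Open Scope R_scope.

(** By the monotone form of l'Hôpital's rule, the quotient [a = m' / m] of two
    functions vanishing at [0] inherits strict monotonicity from the quotient
    [p = m'' / m'] of their derivatives, and moreover [p < a].  If [b] and [q]
    are the same rates for a second function of the class, then (C4) for the
    product says that [(p a + q b + 2 a b) / (a + b)] decreases.  This
    expression clearly increases in [p] and [q]; it increases in [a] and [b]
    because [p - q + 2 b > 0] and [q - p + 2 a > 0], which follows from
    [0 < p < a] and [0 < q < b].  All four rates decrease, hence so does it. *)

Lemma derivative_on_continuous (D : R -> Prop) (f df : R -> R) :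
  derivative_on D f df -> continuous_on D f.
Proof. intros Hf s Hs; exact (cont_deriv _ _ _ _ (Hf s Hs)). Qed.

Lemma derivative_on_plus (D : R -> Prop) (f df g dg : R -> R) :
  derivative_on D f df -> derivative_on D g dg ->
  derivative_on D (fun s => f s + g s) (fun s => df s + dg s).
Proof. intros Hf Hg s Hs; apply Dadd; auto. Qed.

Lemma continuous_on_plus (D : R -> Prop) (f g : R -> R) :
  continuous_on D f -> continuous_on D g ->
  continuous_on D (fun s => f s + g s).
Proof. intros Hf Hg s Hs; apply limit_plus; [apply Hf | apply Hg]; exact Hs. Qed.

Lemma continuous_on_mult (D : R -> Prop) (f g : R -> R) :
  continuous_on D f -> continuous_on D g ->
  continuous_on D (fun s => f s * g s).
Proof. intros Hf Hg s Hs; apply limit_mul; [apply Hf | apply Hg]; exact Hs. Qed.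

Definition product_derivative (f f' g g' : R -> R) (s : R) : R :=
  f' s * g s + f s * g' s.

Definition product_second_derivative (f f' f'' g g' g'' : R -> R) (s : R) : R :=
  product_derivative f' f'' g g' s + product_derivative f f' g' g'' s.

Lemma derivative_on_mult (D : R -> Prop) (f f' g g' : R -> R) :
  derivative_on D f f' -> derivative_on D g g' ->
  derivative_on D (fun s => f s * g s) (product_derivative f f' g g').
Proof. intros Hf Hg s Hs; apply Dmult; auto. Qed.

Lemma C2_01_mult (f f' f'' g g' g'' : R -> R) :
  C2_01 f f' f'' -> C2_01 g g' g'' ->
  C2_01 (fun s => f s * g s) (product_derivative f f' g g')
    (product_second_derivative f f' f'' g g' g'').
Proof.
  intros (df & df' & cf'') (dg & dg' & cg'').
  pose proof (derivative_on_continuous _ _ _ df) as cf.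
  pose proof (derivative_on_continuous _ _ _ df') as cf'.
  pose proof (derivative_on_continuous _ _ _ dg) as cg.
  pose proof (derivative_on_continuous _ _ _ dg') as cg'.
  repeat split.
  - now apply derivative_on_mult.
  - apply derivative_on_plus; now apply derivative_on_mult.
  - repeat apply continuous_on_plus; now apply continuous_on_mult.
Qed.

Lemma D_in_derivable_pt_lim (D : R -> Prop) (f df : R -> R) (a b x : R) :
  a < x < b -> (forall y, a < y < b -> D y) ->
  D_in f df D x -> derivable_pt_lim f x (df x).
Proof.
  intros Hx HD Hf; apply derivable_pt_lim_D_in.
  intros eps Heps; destruct (Hf eps Heps) as (del & Hdel & Hlim).
  exists (Rmin del (Rmin (x - a) (b - x))); split.
  { repeat apply Rmin_glb_lt; lra. }
  intros y [[_ Hneq] Hy]; simpl in Hy; unfold Rdist in Hy.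
  apply Rmin_Rgt_l in Hy as [Hy_del Hy].
  apply Rmin_Rgt_l in Hy as [Hy_a Hy_b].
  apply Rabs_def2 in Hy_a; apply Rabs_def2 in Hy_b.
  apply Hlim; repeat split; [apply HD; lra | exact Hneq | exact Hy_del].
Qed.

Lemma continue_in_comp (D : R -> Prop) (f phi : R -> R) (x : R) :
  (forall y, D (phi y)) -> continue_in f D (phi x) -> continuity_pt phi x ->
  continuity_pt (fun y => f (phi y)) x.
Proof.
  intros HD Hf Hphi eps Heps.
  destruct (Hf eps Heps) as (eta & Heta & Hf_lim).
  destruct (Hphi eta Heta) as (del & Hdel & Hphi_lim).
  exists del; split; [exact Hdel|].
  intros y Hy; destruct (Req_dec (phi x) (phi y)) as [Heq | Hneq].
  - simpl; unfold Rdist; now rewrite Heq, Rminus_diag, Rabs_R0.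
  - apply Hf_lim; split; [split; auto | now apply Hphi_lim].
Qed.

(* Composing with [clamp a b] extends a function on [[a, b]] to all of [R], so
   that the two-sided mean value theorem applies despite the one-sided
   derivatives at the end points. *)
Definition clamp (a b x : R) : R := Rmax a (Rmin b x).

Lemma clamp_in (a b x : R) : a <= b -> a <= clamp a b x <= b.
Proof.
  intros Hab; split; [apply Rmax_l|].
  apply Rmax_lub; [exact Hab | apply Rmin_l].
Qed.

Lemma clamp_id (a b x : R) : a <= x <= b -> clamp a b x = x.
Proof. intros Hx; unfold clamp; rewrite Rmin_right, Rmax_right; lra. Qed.

Lemma clamp_nonexpansive (a b x y : R) :
  Rabs (clamp a b x - clamp a b y) <= Rabs (x - y).
Proof.
  unfold clamp, Rmax, Rmin, Rabs.
  repeat destruct (Rle_dec _ _); repeat destruct (Rcase_abs _); lra.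
Qed.

Lemma continuity_clamp (a b : R) : continuity (clamp a b).
Proof.
  intros x eps Heps; exists eps; split; [exact Heps|].
  intros y [_ Hy]; exact (Rle_lt_trans _ _ _ (clamp_nonexpansive a b y x) Hy).
Qed.

Section MeanValue.

Variables (D : R -> Prop) (a b : R).
Hypothesis Hab : a < b.
Hypothesis HD : forall x, a <= x <= b -> D x.

Lemma continuity_pt_comp_clamp (f : R -> R) (x : R) :
  continuous_on D f -> continuity_pt (fun y => f (clamp a b y)) x.
Proof.
  intros Hf; assert (Hclamp : forall y, D (clamp a b y)).
  { intros y; apply HD, clamp_in; lra. }
  apply (continue_in_comp D); [exact Hclamp | now apply Hf | apply continuity_clamp].
Qed.

Lemma derivable_pt_lim_comp_clamp (f df : R -> R) (x : R) :
  derivative_on D f df -> a < x < b ->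
  derivable_pt_lim (fun y => f (clamp a b y)) x (df x).
Proof.
  intros Hf Hx.
  apply (derivable_pt_lim_locally_ext f _ x a b); [exact Hx | |].
  - intros y Hy; rewrite clamp_id; lra.
  - apply (D_in_derivable_pt_lim D _ _ a b); [exact Hx | |].
    + intros y Hy; apply HD; lra.
    + apply Hf, HD; lra.
Qed.

Lemma Cauchy_mean_value (f df g dg : R -> R) :
  derivative_on D f df -> derivative_on D g dg ->
  exists c, a < c < b /\ (g b - g a) * df c = (f b - f a) * dg c.
Proof.
  intros Hf Hg.
  destruct (MVT (fun y => f (clamp a b y)) (fun y => g (clamp a b y)) a b
    (fun c Hc => exist _ (df c) (derivable_pt_lim_comp_clamp f df c Hf Hc))
    (fun c Hc => exist _ (dg c) (derivable_pt_lim_comp_clamp g dg c Hg Hc)) Hab)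
    as (c & Hc & E).
  - intros c _; apply continuity_pt_comp_clamp.
    exact (derivative_on_continuous _ _ _ Hf).
  - intros c _; apply continuity_pt_comp_clamp.
    exact (derivative_on_continuous _ _ _ Hg).
  - exists c; split; [exact Hc|].
    rewrite !clamp_id in E by lra; exact E.
Qed.

End MeanValue.

Lemma derivative_pos_increasing (a b : R) (f df : R -> R) (s t : R) :
  derivative_on (fun x => a <= x <= b) f df ->
  (forall x, a < x < b -> 0 < df x) ->
  a <= s -> s < t -> t <= b -> f s < f t.
Proof.
  intros Hf df_pos Has Hst Htb.
  destruct (Cauchy_mean_value (fun x => a <= x <= b) s t Hst ltac:(intros; lra)
    f df (fun x => x) (fun _ => 1) Hf) as (c & Hc & E).
  { intros x _; apply Dx. }
  assert (0 < (t - s) * df c).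
  { apply Rmult_lt_0_compat; [| apply df_pos]; lra. }
  lra.
Qed.

Lemma mediant_lt_left (x1 y1 x2 y2 : R) :
  0 < y1 -> y1 < y2 -> (x2 - x1) / (y2 - y1) < x1 / y1 -> x2 / y2 < x1 / y1.
Proof.
  intros Hy1 Hy12 Hlt.
  assert (Hcross : x2 - x1 < x1 / y1 * (y2 - y1)) by (apply Rlt_div_l; lra).
  apply Rlt_div_l; [lra|].
  replace x2 with (x2 - x1 + x1 / y1 * y1) by (field; lra).
  lra.
Qed.

Section MonotoneLHopital.

Variables (a b : R) (f df g dg : R -> R).
Hypothesis Hf : derivative_on (fun s => a <= s <= b) f df.
Hypothesis Hg : derivative_on (fun s => a <= s <= b) g dg.
Hypothesis dg_pos : forall s, a < s < b -> 0 < dg s.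

Lemma increment_quotient_mean_value (s t : R) :
  a <= s -> s < t -> t <= b ->
  exists c, s < c < t /\ (f t - f s) / (g t - g s) = df c / dg c.
Proof.
  intros Has Hst Htb.
  pose proof (derivative_pos_increasing a b g dg s t Hg dg_pos Has Hst Htb) as Hlt.
  assert (Hsub : forall x, s <= x <= t -> a <= x <= b) by (intros x Hx; lra).
  destruct (Cauchy_mean_value _ s t Hst Hsub f df g dg Hf Hg) as (c & Hc & E).
  exists c; split; [exact Hc|].
  assert (Hdg : 0 < dg c) by (apply dg_pos; lra).
  replace (f t - f s) with ((g t - g s) * df c / dg c) by (rewrite E; field; lra).
  field; lra.
Qed.

Hypothesis fa0 : f a = 0.
Hypothesis ga0 : g a = 0.
Hypothesis derivative_quotient_decreasing :
  strictly_decreasing_on (fun s => a < s < b) (fun s => df s / dg s).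

Lemma LHopital_derivative_quotient_lt (s : R) :
  a < s < b -> df s / dg s < f s / g s.
Proof.
  intros Hs.
  destruct (increment_quotient_mean_value a s) as (c & Hc & E); try lra.
  rewrite fa0, ga0, !Rminus_0_r in E; rewrite E.
  apply derivative_quotient_decreasing; lra.
Qed.

Lemma LHopital_quotient_decreasing :
  strictly_decreasing_on (fun s => a < s <= b) (fun s => f s / g s).
Proof.
  intros s t Hs Ht Hst.
  destruct (increment_quotient_mean_value s t) as (c & Hc & E); try lra.
  apply mediant_lt_left.
  - rewrite <- ga0; apply (derivative_pos_increasing a b g dg); auto; lra.
  - apply (derivative_pos_increasing a b g dg); auto; lra.
  - rewrite E; apply Rlt_trans with (df s / dg s).
    + apply derivative_quotient_decreasing; lra.
    + apply LHopital_derivative_quotient_lt; lra.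
Qed.

End MonotoneLHopital.

Definition decreasing_growth_rates (D : R -> Prop) (m m' m'' : R -> R) : Prop :=
  (forall s, D s -> 0 < m s /\ 0 < m' s /\ 0 < m'' s) /\
  (forall s, D s -> m'' s / m' s < m' s / m s) /\
  strictly_decreasing_on D (fun s => m' s / m s) /\
  strictly_decreasing_on D (fun s => m'' s / m' s).

Lemma decreasing_growth_rates_of_second_rate (a b : R) (m m' m'' : R -> R) :
  derivative_on (fun s => a <= s <= b) m m' ->
  derivative_on (fun s => a <= s <= b) m' m'' ->
  m a = 0 -> m' a = 0 -> (forall s, a < s < b -> 0 < m'' s) ->
  strictly_decreasing_on (fun s => a < s < b) (fun s => m'' s / m' s) ->
  decreasing_growth_rates (fun s => a < s < b) m m' m''.
Proof.
  intros Hm Hm' ma0 m'a0 m''_pos Hdec.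
  assert (m'_pos : forall s, a < s < b -> 0 < m' s).
  { intros s Hs; rewrite <- m'a0.
    apply (derivative_pos_increasing a b m' m''); auto; lra. }
  assert (m_pos : forall s, a < s < b -> 0 < m s).
  { intros s Hs; rewrite <- ma0.
    apply (derivative_pos_increasing a b m m'); auto; lra. }
  repeat split; auto.
  - now apply (LHopital_derivative_quotient_lt a b).
  - intros s t Hs Ht Hst.
    apply (LHopital_quotient_decreasing a b m' m'' m m'); auto; lra.
Qed.

Definition product_rate (a p b q : R) : R :=
  (p * a + q * b + 2 * (a * b)) / (a + b).

Lemma product_rateE (f f' f'' g g' g'' : R -> R) (s : R) :
  0 < f s -> 0 < f' s -> 0 < g s -> 0 < g' s ->
  product_second_derivative f f' f'' g g' g'' s / product_derivative f f' g g' s =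
  product_rate (f' s / f s) (f'' s / f' s) (g' s / g s) (g'' s / g' s).
Proof.
  intros Hf Hf' Hg Hg'.
  assert (0 < f' s * g s) by now apply Rmult_lt_0_compat.
  assert (0 < f s * g' s) by now apply Rmult_lt_0_compat.
  unfold product_rate, product_second_derivative, product_derivative.
  field; repeat split; lra.
Qed.

Lemma product_rate_sym (a p b q : R) : product_rate a p b q = product_rate b q a p.
Proof. unfold product_rate; f_equal; ring. Qed.

Lemma product_rate_le_first_rate (a1 a2 p b q : R) :
  0 < a2 -> a2 <= a1 -> 0 <= b -> q <= p + 2 * b ->
  product_rate a2 p b q <= product_rate a1 p b q.
Proof.
  intros Ha2 Ha Hb Hpq; apply Rminus_le_0.
  replace (product_rate a1 p b q - product_rate a2 p b q) with
    ((a1 - a2) * (b * (p - q + 2 * b)) * / ((a1 + b) * (a2 + b)))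
    by (unfold product_rate; field; lra).
  repeat apply Rmult_le_pos; try lra.
  apply Rlt_le, Rinv_0_lt_compat, Rmult_lt_0_compat; lra.
Qed.

Lemma product_rate_lt_second_rate (a p1 p2 b q : R) :
  0 < a -> 0 <= b -> p2 < p1 -> product_rate a p2 b q < product_rate a p1 b q.
Proof.
  intros Ha Hb Hp; unfold product_rate, Rdiv.
  apply Rmult_lt_compat_r; [apply Rinv_0_lt_compat; lra|].
  assert (p2 * a < p1 * a) by now apply Rmult_lt_compat_r.
  lra.
Qed.

Lemma product_rate_lt (a1 a2 p1 p2 b1 b2 q1 q2 : R) :
  0 < a2 -> 0 < b2 -> a2 <= a1 -> b2 <= b1 -> p2 < p1 -> q2 < q1 ->
  q2 <= p2 + 2 * b2 -> p2 <= q2 + 2 * a2 ->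
  product_rate a2 p2 b2 q2 < product_rate a1 p1 b1 q1.
Proof.
  intros Ha2 Hb2 Ha Hb Hp Hq Hqp Hpq.
  apply Rle_lt_trans with (product_rate a1 p2 b2 q2).
  { apply product_rate_le_first_rate; lra. }
  apply Rle_lt_trans with (product_rate a1 p2 b1 q2).
  { rewrite !(product_rate_sym a1); apply product_rate_le_first_rate; lra. }
  apply Rlt_trans with (product_rate a1 p1 b1 q2).
  { apply product_rate_lt_second_rate; lra. }
  rewrite !(product_rate_sym a1); apply product_rate_lt_second_rate; lra.
Qed.

Lemma product_second_rate_decreasing (D : R -> Prop) (f f' f'' g g' g'' : R -> R) :
  decreasing_growth_rates D f f' f'' -> decreasing_growth_rates D g g' g'' ->
  strictly_decreasing_on D (fun s =>
    product_second_derivative f f' f'' g g' g'' s / product_derivative f f' g g' s).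
Proof.
  intros (f_pos & f_rates & f_first & f_second).
  intros (g_pos & g_rates & g_first & g_second).
  intros s t Hs Ht Hst.
  destruct (f_pos s Hs) as (fs & f's & _), (g_pos s Hs) as (gs & g's & _).
  destruct (f_pos t Ht) as (ft & f't & f''t), (g_pos t Ht) as (gt & g't & g''t).
  rewrite !product_rateE by assumption.
  pose proof (Rdiv_lt_0_compat _ _ f''t f't).
  pose proof (Rdiv_lt_0_compat _ _ f't ft).
  pose proof (Rdiv_lt_0_compat _ _ g''t g't).
  pose proof (Rdiv_lt_0_compat _ _ g't gt).
  specialize (f_rates t Ht); specialize (g_rates t Ht).
  specialize (f_first s t Hs Ht Hst); specialize (g_first s t Hs Ht Hst).
  apply product_rate_lt; auto; lra.
Qed.

Theorem corollary1 (m1 m2 : R -> R) (hm1 : class_M m1) (hm2 : class_M m2) :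
  class_M (fun s => m1 s * m2 s).
Proof.
  destruct hm1 as (f' & f'' & Cf & (f_pos & f0) & (f'_pos & f'0) & f''_pos & f_dec).
  destruct hm2 as (g' & g'' & Cg & (g_pos & g0) & (g'_pos & g'0) & g''_pos & g_dec).
  exists (product_derivative m1 f' m2 g'),
    (product_second_derivative m1 f' f'' m2 g' g'').
  split; [now apply C2_01_mult|].
  unfold product_second_derivative, product_derivative.
  repeat split.
  - intros s Hs; apply Rmult_lt_0_compat; auto.
  - rewrite f0; ring.
  - intros s Hs; apply Rplus_lt_0_compat; apply Rmult_lt_0_compat; auto.
  - rewrite f0, f'0; ring.
  - intros s Hs; repeat apply Rplus_lt_0_compat; apply Rmult_lt_0_compat; auto.
  - destruct Cf as (df & df' & _), Cg as (dg & dg' & _).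
    apply product_second_rate_decreasing;
      apply decreasing_growth_rates_of_second_rate; auto;
      intros s Hs; [apply f''_pos | apply g''_pos]; lra.
Qed.
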